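(* Let $\alpha\in(0,1)$. The set of functions $f \in C^{\alpha}[0,1]$ such that $h_{f}(x) = \alpha$ for every $x \in [0,1]$ is $\mathfrak{c}$-lineable.
   Context: $C^{\alpha}[0,1]$ is the set of functions $f:[0,1]\to\mathbb{R}$ for which there is $C>0$ with $|f(x)-f(y)|\le C|x-y|^{\alpha}$ for all $x,y\in[0,1]$. Hölder exponent: let $f:[0,1]\to\mathbb{R}$ be locally bounded, $x_0\in[0,1]$ and $\beta\ge0$. We write $f\in C^{\beta}(x_0)$ if there exist a constant $C>0$ and a polynomial $P_{x_0}$ of degree at most $[\beta]$ (integer part), both depending on $x_0$, such that $|f(x)-P_{x_0}(x)|\le C|x-x_0|^{\beta}$ for every $x$ in a neighborhood of $x_0$ (in $[0,1]$). The Hölder exponent of $f$ at $x_0$ is $h_f(x_0)=\sup\{\beta\ge0 : f\in C^{\beta}(x_0)\}\in[0,+\infty]$. Lineability: a subset $M$ of a real vector space $X$ is $\kappa$-lineable ($\kappa$ a cardinal) if $M\cup\{0\}$ contains a vector subspace of $X$ of dimension $\kappa$. $\mathfrak{c}$ is the cardinality of $\mathbb{R}$. *)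

(* Defs.v *)
From mathcomp Require Import all_boot all_order all_algebra.
From mathcomp Require Import all_classical all_reals all_analysis.

Set Implicit Arguments.
Unset Strict Implicit.
Unset Printing Implicit Defensive.

Import Order.TTheory GRing.Theory Num.Theory.
Import numFieldNormedType.Exports.

Local Open Scope classical_set_scope.
Local Open Scope ring_scope.
Local Open Scope card_scope.

(** The unit interval as a type: a function [unit_itv R -> R] is defined on
    [0, 1] only, and these functions form an [lmodType R] pointwise. As a
    [set_type], it carries the topology induced by [R]. *)
Notation unit_itv R := (set_type (`[0%R, 1%R]%classic : set R)).

Section Lineability.
Context {R : realType} {X : lmodType R}.
Implicit Types B V M : set X.

Definition linearly_independent B : Prop :=
  forall (n : nat) (v : 'I_n -> X) (c : 'I_n -> R),
    injective v -> (forall i, B (v i)) ->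
    \sum_(i < n) c i *: v i = 0 -> forall i, c i = 0.

Definition linear_span B : set X :=
  [set x | exists (n : nat) (v : 'I_n -> X) (c : 'I_n -> R),
     (forall i, B (v i)) /\ x = \sum_(i < n) c i *: v i].

Definition hamel_basis V B : Prop :=
  linearly_independent B /\ linear_span B = V.

(** A cardinal is represented by any set [K] having that cardinality. *)
Definition has_dimension {U : Type} V (K : set U) : Prop :=
  exists B, hamel_basis V B /\ B #= K.

Definition lineable {U : Type} (K : set U) M : Prop :=
  exists V, [/\ GRing.submod_closed [in V], has_dimension V K
              & V `<=` M `|` [set 0]].

End Lineability.

Section HolderExponent.
Context {R : realType}.
Implicit Types (f : unit_itv R -> R) (x : unit_itv R) (a b : R).

Definition holder_space a : set (unit_itv R -> R) :=
  [set f | exists2 C : R, 0 < C &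
     forall x y : unit_itv R,
       `|f x - f y| <= C * `|val x - val y| `^ a].

(** Recall that [size P] is the degree of [P] plus one; [Num.truncn b] is the
    integer part of [b] for [0 <= b]. For [b = 0] the convention of [powR] is
    [0 `^ 0 = 1], so that [pointwise_holder 0 x0 f] means that [f] is bounded
    near [x0]. *)
Definition pointwise_holder b (x0 : unit_itv R) f : Prop :=
  exists (C : R) (P : {poly R}),
    [/\ 0 < C, (size P <= (Num.truncn b).+1)%N &
        \forall x \near x0,
          `|f x - P.[val x]| <= C * `|val x - val x0| `^ b].

(** The exponent is meant for locally bounded [f], for which the set of
    admissible [b] contains [0]. *)
Definition holder_exponent f (x0 : unit_itv R) : \bar R :=
  ereal_sup [set b%:E | b in [set b : R | 0 <= b /\ pointwise_holder b x0 f]].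

End HolderExponent.

(* Main.v *)
Require Import Defs.
From mathcomp Require Import all_boot all_order all_algebra.
From mathcomp Require Import all_classical all_reals all_analysis.
From mathcomp Require Import ring lra.

Set Implicit Arguments.
Unset Strict Implicit.
Unset Printing Implicit Defensive.

Import Order.TTheory GRing.Theory Num.Theory.
Import numFieldNormedType.Exports.

Local Open Scope classical_set_scope.
Local Open Scope ring_scope.

(** Take the Takagi-type series [f_c x = \sum_m c_m 2^(- alpha m) tent (2^m x)],
    where [tent] is the distance to the nearest integer and [|c_m| <= 1]. It is
    alpha-Hölder, and its second difference on a dyadic interval of length
    [2^-n] is exactly [- c_n 2^(- alpha n)]: the terms of index [m < n] are
    affine there and those of index [m > n] vanish at the three points. Every
    point lies in dyadic intervals of all generations, so if [c] does not tend
    to [0] the exponent is at most alpha everywhere. Letting [c] run over the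
    indicators of an almost disjoint family of subsets of [nat] indexed by the
    reals, the coefficient sequence of a linear combination takes each of the
    combination's coefficients infinitely often. *)

(** * Size of the ratio 2^(-a) *)

Lemma gt1_ltr_powR {R : realType} (a : R) : 1 < a ->
  {homo powR a : x y / x < y}.
Proof.
move=> a1 x y xy; have a0 : 0 < a by apply: lt_trans a1.
by rewrite /powR gt_eqF// ltr_expR ltr_pM2r// ln_gt0.
Qed.

Lemma powR2N_lt1 {R : realType} (a : R) : 0 < a -> 2 `^ (- a) < 1 :> R.
Proof.
by move=> a0; rewrite -[ltRHS](powRr0 2) gt1_ltr_powR ?ltr1n// oppr_lt0.
Qed.

Lemma powR2N_gt_half {R : realType} (a : R) : a < 1 -> 2^-1 < 2 `^ (- a) :> R.
Proof.
by move=> a1; rewrite -[ltLHS]powR_inv1// gt1_ltr_powR ?ltr1n// ltrN2.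
Qed.

(** * The distance to the nearest integer and the partial sums of the series *)

Section Tent.
Context {R : realType}.
Implicit Types (x y w : R) (c : nat -> R).

Definition tent x : R := `|x - (Num.floor (x + 2^-1))%:~R|.

Lemma tent_ge0 x : 0 <= tent x. Proof. exact: normr_ge0. Qed.

Lemma tent_le_half x : tent x <= 2^-1.
Proof.
rewrite /tent; have := floor_itv (x + 2^-1); rewrite intrD => /andP[h1 h2].
by rewrite ler_norml; lra.
Qed.

(** The rounded integer is within 1/2 of [x]; any other integer is at distance at least 1 from it,
    hence at least 1/2 from [x]. *)
Lemma tent_le_dist x (k : int) : tent x <= `|x - k%:~R|.
Proof.
have := tent_le_half x; rewrite /tent.
set m := Num.floor _ => h.
have [->//|km] := eqVneq k m.
have : (1 : R) <= `|m%:~R - k%:~R|.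
  rewrite -intrB -intr_norm ler1z -gtz0_ge1 normr_gt0 subr_eq0.
  by rewrite eq_sym.
have := ler_distD x m%:~R k%:~R; rewrite (distrC _ x); lra.
Qed.

(** By symmetry it suffices to bound the larger value, at [x], by the distance from [x] to the
    integer nearest to [y]. *)
Lemma tent_lipschitz x y : `|tent x - tent y| <= `|x - y|.
Proof.
wlog : x y / tent y <= tent x.
  move=> h; case: (leP (tent y) (tent x)) => [|/ltW] /h //.
  by rewrite distrC (distrC x).
move=> yx; rewrite ger0_norm ?subr_ge0// lerBlDr.
apply: le_trans (tent_le_dist x (Num.floor (y + 2^-1))) _.
exact: ler_distD.
Qed.

Lemma tent_int (k : int) : tent k%:~R = 0.
Proof.
apply/eqP; rewrite eq_le tent_ge0 andbT.
by have := tent_le_dist k%:~R k; rewrite subrr normr0.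
Qed.

(** For the lower bound, the rounded integer is at most [i] or at least [i + 1]; neither case brings
    it closer to [x] than [i]. *)
Lemma tent_ascending (i : int) x : i%:~R <= x <= i%:~R + 2^-1 ->
  tent x = x - i%:~R.
Proof.
move=> /andP[h1 h2]; apply/eqP; rewrite eq_le; apply/andP; split.
  by have := tent_le_dist x i; rewrite ger0_norm// subr_ge0.
rewrite /tent; set m := Num.floor _; rewrite ler_normr.
have [mi|im] := leP m i.
  by move: mi; rewrite -(ler_int R) => mi; apply/orP; left; lra.
move: im; rewrite -lezD1 -(ler_int R) intrD => im.
by apply/orP; right; lra.
Qed.

Lemma tent_descending (i : int) x : i%:~R + 2^-1 <= x <= i%:~R + 1 ->
  tent x = i%:~R + 1 - x.
Proof.
move=> /andP[h1 h2]; apply/eqP; rewrite eq_le; apply/andP; split.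
  have := tent_le_dist x (i + 1); rewrite intrD ler0_norm; lra.
rewrite /tent; set m := Num.floor _; rewrite ler_normr.
have [mi|im] := leP m i.
  by move: mi; rewrite -(ler_int R) => mi; apply/orP; left; lra.
move: im; rewrite -lezD1 -(ler_int R) intrD => im.
by apply/orP; right; lra.
Qed.

Definition second_diff (f : R -> R) x h : R :=
  f x - f (x + h / 2) *+ 2 + f (x + h).

Lemma second_diff_tent_int (k : int) : second_diff tent k%:~R 1 = -1.
Proof.
have k1 : k%:~R + 1 = (k + 1)%:~R :> R by rewrite intrD.
rewrite /second_diff k1 !tent_int.
by rewrite (@tent_ascending k); lra.
Qed.

(** The interval lies in some [j/2, (j+1)/2], where [tent] is affine: [j] is the quotient of [k] by
    2^n, and its parity decides the sign of the slope. *)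
Lemma second_diff_tent_dyadic (n k : nat) :
  second_diff tent (k%:R / 2 ^+ n.+1) (2 ^+ n.+1)^-1 = 0.
Proof.
have p0 : (0 : R) < 2 ^+ n by rewrite exprn_gt0.
have [j [r [kE rn]]] : exists j r, k = (j * 2 ^ n + r)%N /\ (r < 2 ^ n)%N.
  by exists (k %/ 2 ^ n)%N, (k %% 2 ^ n)%N; rewrite -divn_eq ltn_mod expn_gt0.
have {}rn : (r%:R + 1 <= 2 ^+ n :> R) by rewrite natr1 -natrX ler_nat.
have r0 : (0 : R) <= r%:R by [].
have -> : k%:R / 2 ^+ n.+1 = j%:R / 2 + r%:R / 2 ^+ n / 2 :> R.
  by rewrite kE natrD natrM natrX exprS; field; rewrite gt_eqF.
have -> : (2 ^+ n.+1)^-1 = (2 ^+ n)^-1 / 2 :> R by rewrite exprS invfM mulrC.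
set e := (2 ^+ n)^-1.
have e0 : 0 < e by rewrite invr_gt0.
set s := r%:R / 2 ^+ n.
have s0 : 0 <= s by rewrite divr_ge0// ltW.
have s1 : s + e <= 1.
  by rewrite /s /e -[X in _ + X]mul1r -mulrDl ler_pdivrMr// mul1r.
have [i [b jE]] : exists i (b : bool), j = (i * 2 + b)%N.
  by exists j./2, (odd j); rewrite muln2 addnC odd_double_half.
rewrite {}jE natrD natrM mulrDl mulfK//.
have iE : i%:R = (i%:Z)%:~R :> R by [].
rewrite /second_diff iE; case: b => /=.
  by rewrite !(@tent_descending i); lra.
by rewrite !(@tent_ascending i); lra.
Qed.

Definition tent_series w c x : nat -> R :=
  series (fun m => c m * w ^+ m * tent (2 ^+ m * x)).

(** Self-similarity: past its first term, the series is [w] times the series of the shifted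
    coefficients at [2 * x]. The inductions on [n] below rest on this, with [c] generalized. *)
Lemma tent_seriesS w c x n : tent_series w c x n.+1 =
  c 0%N * tent x + w * tent_series w (c \o S) (2 * x) n.
Proof.
rewrite /tent_series /series /= big_nat_recl// !expr0 mulr1 mul1r.
congr (_ + _); rewrite mulr_sumr; apply: eq_bigr => m _ /=.
by rewrite !exprS (mulrA _ 2) (mulrC _ 2); ring.
Qed.

(** Doubling the argument lowers the generation by one, and the first term drops out because it is
    affine there. At generation 0 only that term remains, between two consecutive integers. *)
Lemma second_diff_tent_series w c n k :
  second_diff (fun x => tent_series w c x n.+1) (k%:R / 2 ^+ n) (2 ^+ n)^-1
  = - (c n * w ^+ n).
Proof.
elim: n c => [|n IHn] c; rewrite /second_diff.
  have := second_diff_tent_int k; rewrite /second_diff.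
  have t0 x : tent_series w (c \o S) x 0 = 0.
    by rewrite /tent_series /series /= big_geq.
  rewrite !tent_seriesS !t0 expr0 invr1 !mulr1 !mulr0 !addr0.
  set a := tent _; set b := tent _; set d := tent _ => h.
  by rewrite -[RHS]mulrN1 -h; ring.
have := second_diff_tent_dyadic n k; have := IHn (c \o S).
rewrite /second_diff => h1 h2.
rewrite !(@tent_seriesS w c _ n.+1) !mulrDr.
have E1 : 2 * (k%:R / 2 ^+ n.+1) = k%:R / 2 ^+ n :> R.
  by rewrite exprS; field; rewrite expf_neq0.
have E2 : 2 * ((2 ^+ n.+1)^-1) = (2 ^+ n)^-1 :> R.
  by rewrite exprS; field; rewrite expf_neq0.
rewrite !(mulrA 2 (_^-1)) E1 E2.
move: h1 h2; set a := tent _; set b := tent _; set d := tent _.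
set a' := tent_series _ _ _ _; set b' := tent_series _ _ _ _.
set d' := tent_series _ _ _ _ => /= h1 h2.
transitivity (c 0%N * (a - b *+ 2 + d) + w * (a' - b' *+ 2 + d')); first ring.
by rewrite h1 h2 exprS; ring.
Qed.

(** For m >= n the number 2^m k / 2^n is an integer, where [tent] vanishes. *)
Lemma tent_series_dyadic w c n (k : nat) N : (n <= N)%N ->
  tent_series w c (k%:R / 2 ^+ n) N = tent_series w c (k%:R / 2 ^+ n) n.
Proof.
move=> nN; rewrite /tent_series /series /= (big_cat_nat (leq0n n) nN)//=.
rewrite [X in _ + X]big_nat_cond [X in _ + X]big1 ?addr0// => m /andP[/andP[nm _] _].
rewrite (_ : 2 ^+ m * _ = ((2 ^ (m - n) * k)%N%:Z)%:~R) ?tent_int ?mulr0//.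
have -> : 2 ^+ m = 2 ^+ (m - n) * 2 ^+ n :> R by rewrite -exprD subnK.
rewrite -[RHS]/(((2 ^ (m - n) * k)%N)%:R) natrM natrX.
by field; rewrite expf_neq0.
Qed.

(** The bound is the fixed point of M = 1 + w M, which self-similarity preserves. *)
Lemma tent_series_bounded w c x n : 0 <= w < 1 -> (forall m, `|c m| <= 1) ->
  `|tent_series w c x n| <= (1 - w)^-1.
Proof.
move=> /andP[w0 w1] c1; elim: n c x c1 => [|n IHn] c x c1.
  by rewrite /tent_series /series /= big_geq// normr0 invr_ge0 subr_ge0 ltW.
rewrite tent_seriesS; have := IHn (c \o S) (2 * x) (fun m => c1 m.+1).
set M := (1 - w)^-1 => h.
have -> : M = 1 + w * M by rewrite /M; field; rewrite subr_eq0 gt_eqF.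
apply: le_trans (ler_normD _ _) _; apply: lerD.
  rewrite normrM (ger0_norm (tent_ge0 x)).
  apply: mulr_ile1 => //; first exact: tent_ge0.
  by have := tent_le_half x; lra.
by rewrite normrM ger0_norm// ler_wpM2l.
Qed.

(* The term [- L d] gives the slack needed for the induction to close: the
   Lipschitz contribution [d] of the first summand is absorbed because
   [1 + L = 2 w L]. *)
Lemma tent_series_holder_aux (a K L w : R) : 0 < a -> a < 1 ->
  w = 2 `^ (- a) -> L = (2 * w - 1)^-1 -> K = 2 * (2 * (1 - w)^-1 + L) ->
  forall n c x y, (forall m, `|c m| <= 1) -> `|x - y| <= 1 ->
  `|tent_series w c x n - tent_series w c y n|
    <= K * `|x - y| `^ a - L * `|x - y|.
Proof.
move=> a0 a1 wE LE KE.
have w_gt0 : 0 < w by rewrite wE powR_gt0.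
have wa : w * 2 `^ a = 1.
  by rewrite wE powRN mulVf// gt_eqF// powR_gt0.
have w_lt1 : w < 1 by rewrite wE powR2N_lt1.
have w_gt_half : 2^-1 < w by rewrite wE powR2N_gt_half.
have L0 : 0 < L by rewrite LE invr_gt0; lra.
have LE' : 1 + L = 2 * w * L by rewrite LE; field; lra.
set M := (1 - w)^-1 in KE.
have M0 : 0 < M by rewrite invr_gt0; lra.
have d_le d : 0 <= d -> d <= 1 -> d <= d `^ a.
  rewrite le_eqVlt => /predU1P[<- _|d0 d1]; first exact: powR_ge0.
  by rewrite ger1_powR ?d0// ltW.
elim=> [|n IHn] c x y c1 xy1.
  rewrite /tent_series /series /= !big_geq// subrr normr0.
  have := d_le _ (normr_ge0 (x - y)) xy1; have := normr_ge0 (x - y).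
  set d := `|_|; set e := _ `^ _; nra.
(* Beyond distance 1/2 the doubled points are too far apart for the induction hypothesis. There the
   uniform bound gives 2 / (1 - w), and [K] is chosen so that (K - L) / 2 exceeds it. *)
have [dh|dh] := leP `|x - y| 2^-1; last first.
  apply: le_trans (ler_normB _ _) _.
  have := @tent_series_bounded w c x n.+1; have := @tent_series_bounded w c y n.+1.
  rewrite w_lt1 ltW// -/M => /(_ isT c1) hy /(_ isT c1) hx.
  have := d_le _ (normr_ge0 (x - y)) xy1.
  move: dh xy1; set d := `|_|; set e := _ `^ _ => dh xy1 de.
  rewrite KE; nra.
rewrite !tent_seriesS.
have := IHn (c \o S) (2 * x) (2 * y) (fun m => c1 m.+1).
rewrite -mulrBr normrM ger0_norm// powRM//.
set u := tent_series _ _ _ _; set v := tent_series _ _ _ _ => h.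
have {}h : `|u - v| <= K * (2 `^ a * `|x - y| `^ a) - L * (2 * `|x - y|).
  by apply: h; lra.
have E : c 0%N * tent x + w * u - (c 0%N * tent y + w * v)
  = c 0%N * (tent x - tent y) + w * (u - v) by ring.
rewrite {}E; apply: le_trans (ler_normD _ _) _.
rewrite !normrM (ger0_norm (ltW w_gt0)).
have h1 : `|c 0%N| * `|tent x - tent y| <= `|x - y|.
  apply: le_trans (tent_lipschitz x y).
  by rewrite ler_piMl.
have h2 : w * `|u - v| <= w * (K * (2 `^ a * `|x - y| `^ a) - L * (2 * `|x - y|)).
  by rewrite ler_wpM2l// ltW.
apply: le_trans (lerD h1 h2) _.
rewrite le_eqVlt; apply/orP; left; apply/eqP.
transitivity ((w * 2 `^ a) * K * `|x - y| `^ a + (1 - 2 * w * L) * `|x - y|).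
  ring.
by rewrite wa -LE'; ring.
Qed.

End Tent.

(** * The limit function: its Hölder bound and its second differences *)

Section TentFunction.
Context {R : realType}.
Implicit Types (x y : R) (c : nat -> R).

Definition tent_fun (a : R) c x : R := limn (tent_series (2 `^ (- a)) c x).

Lemma cvg_tent_series (a : R) c x : 0 < a -> (forall m, `|c m| <= 1) ->
  cvgn (tent_series (2 `^ (- a)) c x).
Proof.
move=> a0 c1; set w := 2 `^ (- a).
have w0 : 0 < w by rewrite powR_gt0.
have w1 : w < 1 by exact: powR2N_lt1.
apply: normed_cvg.
apply: (@series_le_cvg _ _ (geometric 1 w)) => [n|n|n|].
- exact: normr_ge0.
- by rewrite /= mul1r exprn_ge0// ltW.
- rewrite /= mul1r !normrM normrX (gtr0_norm w0) (ger0_norm (tent_ge0 _)).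
  rewrite mulrAC ler_piMl ?exprn_ge0 ?(ltW w0)//.
  apply: mulr_ile1 => //; first exact: tent_ge0.
  by have := tent_le_half (2 ^+ n * x); lra.
- by apply: is_cvg_geometric_series; rewrite gtr0_norm.
Qed.

(** The constant is chosen before [c], so that a single one serves all members of a linear
    combination. *)
Lemma tent_fun_holder (a : R) : 0 < a -> a < 1 -> exists2 K, 0 < K &
  forall c x y, (forall m, `|c m| <= 1) -> `|x - y| <= 1 ->
  `|tent_fun a c x - tent_fun a c y| <= K * `|x - y| `^ a.
Proof.
move=> a0 a1; set w := 2 `^ (- a); set L := (2 * w - 1)^-1.
set K := 2 * (2 * (1 - w)^-1 + L).
have w1 : w < 1 by exact: powR2N_lt1.
have w_gt_half : 2^-1 < w by exact: powR2N_gt_half.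
have L0 : 0 < L by rewrite invr_gt0; lra.
have M0 : 0 < (1 - w)^-1 by rewrite invr_gt0; lra.
exists K => [|c x y c1 xy1]; first by rewrite /K; lra.
have cx := @cvg_tent_series a c x a0 c1; have cy := @cvg_tent_series a c y a0 c1.
rewrite /tent_fun -limB// -lim_norm; last exact: is_cvgB.
apply: limr_le; first by apply: is_cvg_norm; apply: is_cvgB.
apply: nearW => n /=.
apply: le_trans (tent_series_holder_aux a0 a1 (erefl w) (erefl L) (erefl K) n c1 xy1) _.
by rewrite gerBl mulr_ge0// ltW.
Qed.

Lemma tent_fun_dyadic (a : R) c n (k : nat) N : (n <= N)%N ->
  tent_fun a c (k%:R / 2 ^+ n) = tent_series (2 `^ (- a)) c (k%:R / 2 ^+ n) N.
Proof.
move=> nN; apply: lim_near_cst => //; exists n => // m /= nm.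
by rewrite !(@tent_series_dyadic _ _ _ n).
Qed.

Lemma second_diff_tent_fun (a : R) c n k :
  second_diff (tent_fun a c) (k%:R / 2 ^+ n) (2 ^+ n)^-1
  = - (c n * (2 `^ (- a)) ^+ n).
Proof.
rewrite -(second_diff_tent_series _ _ _ k) /second_diff.
have p0 : (2 : R) ^+ n != 0 by rewrite expf_neq0.
(* The midpoint is dyadic of generation [n.+1]; with this common denominator the limit at all three
   points is the partial sum of length [n.+1]. *)
have -> : k%:R / 2 ^+ n = (k * 2)%:R / 2 ^+ n.+1 :> R.
  by rewrite natrM exprS; field.
have -> : (k * 2)%:R / 2 ^+ n.+1 + (2 ^+ n)^-1 / 2 = (k * 2 + 1)%:R / 2 ^+ n.+1 :> R.
  by rewrite natrD exprS; field.
have -> : (k * 2)%:R / 2 ^+ n.+1 + (2 ^+ n)^-1 = (k * 2 + 2)%:R / 2 ^+ n.+1 :> R.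
  by rewrite natrD exprS; field.
by rewrite !(@tent_fun_dyadic _ _ n.+1 _ n.+1).
Qed.

End TentFunction.

(** * An almost disjoint family of sets of naturals indexed by the reals *)

Section AlmostDisjoint.
Context {R : realType}.
Implicit Types (s t : R) (r : seq R).

(* The supports [{floor_code t n | n}] are pairwise almost disjoint: for
   [s != t] the integers [floor (s n)] and [floor (t n)] differ for large n. *)
Definition floor_code t n : nat := pickle (n, Num.floor (t * n%:R)).

Definition floor_code_ind t m : R := `[< exists n, m = floor_code t n >]%:R.

Lemma floor_code_ind_le1 t m : `|floor_code_ind t m| <= 1.
Proof. by rewrite /floor_code_ind; case: asbool; rewrite ?normr1 ?normr0. Qed.

(** Two reals with equal floors differ by less than 1, which fails for [s * n] and [t * n] once n
    exceeds 1 / |s - t|; a finite list takes the largest threshold. *)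
Lemma floor_neq_eventually s r : s \notin r -> exists n0, forall n, (n0 <= n)%N ->
  forall t, t \in r -> Num.floor (s * n%:R) != Num.floor (t * n%:R).
Proof.
elim: r => [|t r IHr]; first by exists 0%N.
rewrite inE negb_or => /andP[st /IHr[n0 n0P]].
exists (maxn n0 (Num.truncn (`|s - t|^-1)).+1) => n.
rewrite geq_max => /andP[n0n n1n] u; rewrite inE => /predU1P[->|/n0P]; last exact.
apply/eqP => E.
have d0 : 0 < `|s - t| by rewrite normr_gt0 subr_eq0.
have : 1 < `|s - t| * n%:R.
  rewrite -(ltr_pdivrMl _ _ d0) mulr1.
  apply: lt_le_trans (_ : (Num.truncn (`|s - t|^-1)).+1%:R <= _); last by rewrite ler_nat.
  exact: truncnS_gt.
rewrite -[n%:R]ger0_norm// -normrM mulrBl ltNge => /negP; apply.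
have := floor_itv (s * n%:R); have := floor_itv (t * n%:R).
rewrite -E !intrD => /andP[h1 h2] /andP[h3 h4].
by rewrite ler_norml; lra.
Qed.

(** Pigeonhole: otherwise [N.+1] consecutive arguments would map injectively below [N]. *)
Lemma nat_inj_unbounded (f : nat -> nat) N : injective f ->
  forall n0, exists2 n, (n0 <= n)%N & (N <= f n)%N.
Proof.
move=> finj n0; apply: contrapT => h.
have fN n : (f (n0 + n) < N)%N.
  rewrite ltnNge; apply/negP => Nf; apply: h.
  by exists (n0 + n)%N => //; rewrite leq_addr.
have /leq_card : injective (fun n : 'I_N.+1 => Ordinal (fN n)).
  by move=> i j [/finj/addnI]; exact: val_inj.
by rewrite !card_ord ltnn.
Qed.

(** A code common to two supports comes from the same [n] and the same floor, which is excluded for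
    large [n]. *)
Lemma floor_code_separated s r N : s \notin r -> exists m, [/\ (N <= m)%N,
  floor_code_ind s m = 1 & forall t, t \in r -> floor_code_ind t m = 0].
Proof.
move=> /floor_neq_eventually[n0 n0P].
have code_inj : injective (floor_code s) by move=> i j /(pcan_inj pickleK)[].
have [n n0n Nn] := nat_inj_unbounded N code_inj n0.
exists (floor_code s n); split => //.
  by rewrite /floor_code_ind asboolT//; exists n.
move=> t tr; rewrite /floor_code_ind asboolF// => -[k /(pcan_inj pickleK)[nk]].
by rewrite -nk => /eqP; apply/negP; exact: n0P.
Qed.

(** Separate [s] from the parameters [t i] that differ from it. Parameters may repeat, whence a sum
    over a fiber of [t]. *)
Lemma floor_code_comb n (t a : 'I_n -> R) s N : exists2 m, (N <= m)%N &
  \sum_i a i * floor_code_ind (t i) m = \sum_(i | t i == s) a i.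
Proof.
have := @floor_code_separated s [seq t i | i <- enum 'I_n & t i != s] N.
case=> [|m [Nm sm rm]].
  by apply/mapP => -[i]; rewrite mem_filter => /andP[+ _] => /[swap] <-; rewrite eqxx.
exists m => //; rewrite [RHS]big_mkcond; apply: eq_bigr => i _.
have [->|tis] := eqVneq (t i) s; first by rewrite sm mulr1.
by rewrite rm ?mulr0//; apply/mapP; exists i => //; rewrite mem_filter tis mem_enum.
Qed.

End AlmostDisjoint.

(** * Computing the Hölder exponent from second differences *)

Section Exponent.
Context {R : realType}.
Implicit Types (x : unit_itv R) (f : unit_itv R -> R) (a b : R).

Lemma nbhs_unit_itvP x (A : set (unit_itv R)) : nbhs x A ->
  exists2 e : R, 0 < e & forall y, `|val y - val x| < e -> A y.
Proof.
rewrite nbhsE => -[U [[B oB <-] Bx] UA].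
have /nbhs_ballP[e /= e0 eB] : nbhs (val x) B by apply: open_nbhs_nbhs.
exists e => // y xy; apply: UA => /=; apply: eB.
by rewrite /ball /= distrC.
Qed.

(** The quotient of P - P(z) by X - z is bounded on [0, 1]. *)
Lemma poly_lipschitz_at (P : {poly R}) (z : R) :
  exists2 L, 0 <= L & forall y, 0 <= y <= 1 -> `|P.[y] - P.[z]| <= L * `|y - z|.
Proof.
have /factor_theorem[Q QE] : root (P - (P.[z])%:P) z.
  by rewrite /root !hornerE subrr.
have [L LP] := poly_itv_bound Q 0 1.
exists `|L| => // y y01.
have -> : P.[y] - P.[z] = Q.[y] * (y - z).
  by have := congr1 (fun p => p.[y]) QE; rewrite !hornerE.
by rewrite normrM ler_wpM2r// (le_trans (LP _ y01))// ler_norm.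
Qed.

(* Since a polynomial is Lipschitz, only its constant term matters for
   exponents up to 1. *)
Lemma pointwise_holder_cst b x f : 0 <= b -> pointwise_holder b x f ->
  exists C p e : R, [/\ 0 <= C, 0 < e & forall y, `|val y - val x| < e ->
    `|f y - p| <= C * `|val y - val x| `^ Num.min b 1].
Proof.
move=> b0 [C [P [C0 _ /nbhs_unit_itvP[e e0 eP]]]].
have in01 (y : unit_itv R) : 0 <= val y <= 1 by have := set_valP y; rewrite /= in_itv.
have [L L0 LP] := poly_lipschitz_at P (val x).
exists (C + L), P.[val x], e; split => //; first by rewrite addr_ge0// ltW.
move=> y /eP h; rewrite -(subrKA P.[val y]) addrC.
have d1 : `|val y - val x| <= 1.
  by have /andP[? ?] := in01 x; have /andP[? ?] := in01 y; rewrite ler_norml; lra.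
have le_min g : 0 <= g -> Num.min b 1 <= g ->
    `|val y - val x| `^ g <= `|val y - val x| `^ Num.min b 1.
  (* At distance 0 the convention 0^0 = 1 matters: [g = 0] forces [b = 0], and both sides are then
     1. *)
  move=> g0 hg; have [->|d0] := eqVneq `|val y - val x| 0.
    have [gE|gn0] := eqVneq g 0; last by rewrite powR0 ?powR_ge0.
    move: hg; rewrite gE ge_min => /orP[hb|]; last by rewrite ler10.
    by have -> : b = 0 by [apply/eqP; rewrite eq_le hb]; rewrite min_l.
  by rewrite ger_powR// d1 andbT lt_def d0 normr_ge0.
rewrite addrC; apply: le_trans (ler_normD _ _) _; rewrite mulrDl lerD//.
  apply: le_trans h _; rewrite ler_wpM2l ?(ltW C0)// le_min//.
  by rewrite ge_min lexx.
apply: le_trans (LP _ (in01 y)) _; rewrite ler_wpM2l//.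
by rewrite -[X in X <= _]powRr1// le_min// ge_min lexx orbT.
Qed.

(** Bisection keeps the interval inside [0, 1] even for [z = 1], where the integer part of 2^n z
    would overshoot. *)
Lemma dyadic_interval n (z : R) : 0 <= z <= 1 -> exists k : nat,
  k%:R / 2 ^+ n <= z <= k%:R / 2 ^+ n + (2 ^+ n)^-1
  /\ k%:R / 2 ^+ n + (2 ^+ n)^-1 <= 1 :> R.
Proof.
elim: n => [|n IHn] z01; first by exists 0%N; rewrite expr0 invr1 mul0r add0r.
have [k [/andP[h1 h2] h3]] := IHn z01.
have p0 : (2 : R) ^+ n != 0 by rewrite expf_neq0.
have e0 : 0 < (2 ^+ n)^-1 :> R by rewrite invr_gt0 exprn_gt0.
have eE : (2 ^+ n.+1)^-1 = (2 ^+ n)^-1 / 2 :> R by rewrite exprS invfM mulrC.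
have [zm|mz] := leP z (k%:R / 2 ^+ n + (2 ^+ n)^-1 / 2).
  exists (k * 2)%N; rewrite eE natrM.
  move: h1 h2 h3 zm e0; set e := (2 ^+ n)^-1; set q := k%:R / _.
  have -> : k%:R * 2 * (e / 2) = q by rewrite /q -/e; field.
  by move=> *; split; lra.
exists (k * 2 + 1)%N; rewrite eE natrD natrM.
move: h1 h2 h3 mz e0; set e := (2 ^+ n)^-1; set q := k%:R / _.
have -> : (k%:R * 2 + 1%:R) * (e / 2) = q + e / 2 by rewrite /q -/e; field.
by move=> *; split; lra.
Qed.

(** On the dyadic interval of length 2^-n around [x], regularity [b] would make the second
    difference of order 2^(-n min(b,1)), too small against 2^(-n a). The interval depends on [x], so
    the lower bound is asked for every [k]. *)
Lemma not_pointwise_holder (g : R -> R) a b d x : 0 < a -> a < 1 -> a < b ->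
  0 < d ->
  (forall N, exists2 n, (N <= n)%N & forall k : nat,
    d * (2 `^ (- a)) ^+ n <= `|second_diff g (k%:R / 2 ^+ n) (2 ^+ n)^-1|) ->
  ~ pointwise_holder b x (g \o val).
Proof.
move=> a0 a1 ab d0 gP /pointwise_holder_cst[|C [p [e [C0 e0 CP]]]].
  by rewrite ltW// (lt_trans a0).
set g' := Num.min b 1 in CP.
have ag : a < g' by rewrite lt_min ab.
have g0 : 0 < g' by apply: lt_trans ag.
(* The ratio of the two decay rates; [n] is taken so large that 4 C q^n < d. *)
pose q : R := 2 `^ (a - g').
have q0 : 0 < q by rewrite powR_gt0.
have q1 : q < 1.
  by rewrite /q -[X in _ < X](powRr0 2) gt1_ltr_powR ?ltr1n// subr_lt0.
have near_q : \forall n \near \oo, (4 * C) * q ^+ n < d.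
  have : geometric (4 * C) q @ \oo --> 0 by apply: cvg_geometric; rewrite gtr0_norm.
  by move=> /cvgr_lt; apply.
have near_e : \forall n \near \oo, 1 * (2^-1 : R) ^+ n < e.
  have : geometric (1 : R) 2^-1 @ \oo --> 0.
    by apply: cvg_geometric; rewrite gtr0_norm ?invr_gt0// invf_lt1// ltr1n.
  by move=> /cvgr_lt; apply.
have [N _ NP] := filterI near_q near_e.
have [n Nn {}gP] := gP N.
have [/= nq ne] := NP n Nn; rewrite mul1r exprVn in ne.
have x01 : 0 <= val x <= 1 by have := set_valP x; rewrite /= in_itv.
have [k [/andP[kx xk] k1]] := dyadic_interval n x01.
have k0 : 0 <= k%:R / 2 ^+ n :> R by rewrite divr_ge0// exprn_ge0.
have h0 : 0 < (2 ^+ n)^-1 :> R by rewrite invr_gt0 exprn_gt0.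
have {}gP := gP k.
move: gP ne kx xk k1 k0 h0.
set z := k%:R / _; set h := (2 ^+ n)^-1 => gP ne kx xk k1 k0 h0.
have close y : z <= y <= z + h -> `|g y - p| <= C * h `^ g'.
  move=> /andP[zy yz].
  have y01 : y \in (`[0, 1]%classic : set R).
    by rewrite inE /= in_itv /=; apply/andP; split; lra.
  have yx : `|y - val x| <= h by rewrite ler_norml; lra.
  have /= := CP (SigSub y01); rewrite /= => /(_ (le_lt_trans yx ne)) hy.
  apply: le_trans hy _; rewrite ler_wpM2l//.
  by rewrite ge0_ler_powR ?nnegrE// ltW.
have c1 : `|g z - p| <= C * h `^ g' by apply: close; lra.
have c2 : `|g (z + h / 2) - p| <= C * h `^ g' by apply: close; lra.
have c3 : `|g (z + h) - p| <= C * h `^ g' by apply: close; lra.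
(* The weights 1, -2, 1 sum to 0, which cancels [p], and their absolute values sum to 4. *)
have : `|second_diff g z h| <= 4 * C * h `^ g'.
  move: c1 c2 c3; rewrite /second_diff !ler_norml -!mulrA.
  by set M := C * _ => /andP[? ?] /andP[? ?] /andP[? ?]; lra.
have -> : h `^ g' = (2 `^ (- g')) ^+ n.
  rewrite /h -powR_inv1 ?exprn_ge0// -!powR_mulrn ?powR_ge0// -!powRrM.
  by congr (_ `^ _); ring.
move=> /(le_trans gP).
have -> : 2 `^ (- g') = 2 `^ (- a) * q.
  by rewrite /q -powRD ?pnatr_eq0 ?implybT//; congr (_ `^ _); ring.
rewrite exprMn mulrCA (mulrC d) ler_pM2l ?exprn_gt0 ?powR_gt0//.
by move=> /(lt_le_trans nq); rewrite ltxx.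
Qed.

(** The value [a] is attained: the global Hölder bound is the pointwise one with the constant
    polynomial g(x). *)
Lemma holder_exponentE (g : R -> R) a d x : 0 < a -> a < 1 -> 0 < d ->
  (g \o val) \in holder_space a ->
  (forall N, exists2 n, (N <= n)%N & forall k : nat,
    d * (2 `^ (- a)) ^+ n <= `|second_diff g (k%:R / 2 ^+ n) (2 ^+ n)^-1|) ->
  holder_exponent (g \o val) x = a%:E.
Proof.
move=> a0 a1 d0 /[!inE] -[C C0 CP] gP; apply/eqP; rewrite eq_le; apply/andP; split.
  apply: ge_ereal_sup => _ [b [b0 bP] <-]; rewrite lee_fin leNgt; apply/negP => ab.
  exact: (not_pointwise_holder a0 a1 ab d0 gP bP).
apply: ereal_sup_ubound; exists a => //; split; first exact: ltW.
exists C, (g (val x))%:P; split => //; first exact: leq_trans (size_polyC_leq1 _) _.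
by apply: (@filterE _ _ (nbhs_filter x)) => y; rewrite hornerC; exact: CP.
Qed.

End Exponent.

(** * Spans, and linear combinations with repeated vectors *)

Section LinearSpan.
Context {R : realType} {X : lmodType R}.

Lemma linear_span_submod (B : set X) : GRing.submod_closed [in linear_span B].
Proof.
split.
  rewrite inE; exists 0%N, (fun _ => 0), (fun _ => 0).
  by split => [[]//|]; rewrite big_ord0.
move=> a u v /[!inE] -[n [vn [cn [vnB ->]]]] [m [vm [cm [vmB ->]]]].
exists (n + m)%N, (fun i => match fintype.split i with inl j => vn j | inr j => vm j end),
  (fun i => match fintype.split i with inl j => a * cn j | inr j => cm j end); split.
  by move=> i; case: fintype.split.
rewrite big_split_ord /= scaler_sumr; congr (_ + _); apply: eq_bigr => i _.
  by rewrite (unsplitK (inl i)) scalerA.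
by rewrite (unsplitK (inr i)).
Qed.

(** Group the terms by the value of [t i]; [r] lists these values once each. *)
Lemma sum_scale_fibers (T : eqType) (F : T -> X) n (t : 'I_n -> T) (a : 'I_n -> R) :
  (forall s, \sum_(i | t i == s) a i = 0) -> \sum_i a i *: F (t i) = 0.
Proof.
move=> a0; pose r := undup [seq t i | i <- enum 'I_n].
transitivity (\sum_i \sum_(s <- r | t i == s) a i *: F s).
  apply: eq_bigr => i _; rewrite -big_filter.
  rewrite (_ : [seq _ <- _ | _] = [:: t i]) ?big_seq1//.
  rewrite (eq_filter (a2 := pred1 (t i))) => [|s]; last by rewrite /= eq_sym.
  by rewrite filter_pred1_uniq ?undup_uniq// mem_undup map_f// mem_enum.
rewrite (exchange_big_dep predT)//= big1// => s _.
by rewrite -scaler_suml a0 scale0r.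
Qed.

End LinearSpan.

(** * Linear combinations of the functions indexed by the reals *)

Section Family.
Context {R : realType}.
Variables (alpha : R) (alpha_gt0 : 0 < alpha) (alpha_lt1 : alpha < 1).

Definition tent_family (t : R) : unit_itv R -> R :=
  tent_fun alpha (floor_code_ind t) \o val.

Lemma sum_tent_familyE n (t a : 'I_n -> R) :
  \sum_i a i *: tent_family (t i) =
  (fun x => \sum_i a i * tent_fun alpha (floor_code_ind (t i)) x) \o val.
Proof. by apply/funext => x; rewrite fct_sumE. Qed.

Lemma sum_tent_family_holder n (t a : 'I_n -> R) :
  \sum_i a i *: tent_family (t i) \in holder_space alpha.
Proof.
have [K K0 KP] := tent_fun_holder alpha_gt0 alpha_lt1.
have A0 : 0 <= \sum_i `|a i| by rewrite sumr_ge0.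
(* The summand 1 keeps the constant positive when all [a i] are 0. *)
rewrite inE; exists ((\sum_i `|a i|) * K + 1); first by rewrite ltr_wpDl// mulr_ge0// ltW.
move=> x y; rewrite sum_tent_familyE /= -sumrB mulrDl mul1r.
have xy1 : `|val x - val y| <= 1.
  have := set_valP x; have := set_valP y; rewrite /= !in_itv /=.
  by move=> /andP[? ?] /andP[? ?]; rewrite ler_norml; lra.
apply: le_trans (_ : _ <= (\sum_i `|a i|) * K * `|val x - val y| `^ alpha) _; last first.
  by rewrite lerDl powR_ge0.
rewrite -mulrA mulr_suml; apply: le_trans (ler_norm_sum _ _ _) _.
apply: ler_sum => i _; rewrite -mulrBr normrM ler_wpM2l//.
by apply: KP => // m; exact: floor_code_ind_le1.
Qed.

(** The second difference is linear, and at the generation [m] of [floor_code_comb] the combined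
    coefficient is the fiber sum over [s]. *)
Lemma second_diff_sum_tent n (t a : 'I_n -> R) s N : exists2 m, (N <= m)%N &
  forall k : nat, second_diff
      (fun x => \sum_i a i * tent_fun alpha (floor_code_ind (t i)) x)
      (k%:R / 2 ^+ m) (2 ^+ m)^-1
    = - ((\sum_(i | t i == s) a i) * (2 `^ (- alpha)) ^+ m).
Proof.
have [m Nm mE] := floor_code_comb t a s N; exists m => // k.
transitivity (\sum_i a i * second_diff (tent_fun alpha (floor_code_ind (t i)))
    (k%:R / 2 ^+ m) (2 ^+ m)^-1).
  rewrite /second_diff -sumrMnl -sumrB -big_split /=.
  by apply: eq_bigr => i _; rewrite mulrDr mulrBr mulrnAr.
rewrite -mE mulr_suml -sumrN; apply: eq_bigr => i _.
by rewrite second_diff_tent_fun mulrN mulrA.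
Qed.

(** The fiber sum is read off the second difference on [0, 2^-m], an interval inside [0, 1], where
    the combination vanishes. *)
Lemma sum_tent_family_eq0 n (t a : 'I_n -> R) :
  \sum_i a i *: tent_family (t i) = 0 -> forall s, \sum_(i | t i == s) a i = 0.
Proof.
rewrite sum_tent_familyE => f0 s.
have [m _ /(_ 0%N)] := second_diff_sum_tent t a s 0.
set g := fun x => \sum_i _ in f0 *.
have g0 y : 0 <= y <= 1 -> g y = 0.
  move=> y01; have y01' : y \in (`[0, 1]%classic : set R) by rewrite inE /= in_itv.
  exact: (congr1 (fun f => f (SigSub y01')) f0).
have h0 : 0 < (2 ^+ m)^-1 :> R by rewrite invr_gt0 exprn_gt0.
have h1 : (2 ^+ m)^-1 <= 1 :> R by rewrite invf_le1 ?exprn_gt0// exprn_ege1// ler1n.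
rewrite /second_diff mul0r !g0; [|lra..].
rewrite mul0rn subr0 addr0 => /esym/eqP.
have w0 : (2 `^ (- alpha)) ^+ m != 0 by rewrite expf_neq0// gt_eqF// powR_gt0.
by rewrite oppr_eq0 mulf_eq0 (negPf w0) orbF => /eqP.
Qed.

(** In the relation F_s - F_t = 0 with s != t, the fiber over [s] would have sum 1. This gives the
    basis the cardinality of the reals. *)
Lemma tent_family_inj : injective tent_family.
Proof.
move=> s t st; apply/eqP/negPn/negP => s_neq_t.
pose p (i : 'I_2) := if i == 0 then s else t.
pose a (i : 'I_2) : R := if i == 0 then 1 else -1.
have : \sum_i a i *: tent_family (p i) = 0.
  by rewrite !big_ord_recl big_ord0 /p /a /= st addr0 scale1r scaleN1r subrr.
move=> /sum_tent_family_eq0/(_ s)/eqP.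
rewrite big_mkcond !big_ord_recl big_ord0 /p /a /= eqxx (eq_sym t) (negPf s_neq_t).
by rewrite !addr0 oner_eq0.
Qed.

Lemma sum_tent_family_exponent n (t a : 'I_n -> R) s (x : unit_itv R) :
  \sum_(i | t i == s) a i != 0 ->
  holder_exponent (\sum_i a i *: tent_family (t i)) x = alpha%:E.
Proof.
move=> A0; have := sum_tent_family_holder t a; rewrite sum_tent_familyE => fa.
apply: (@holder_exponentE _ _ _ `|\sum_(i | t i == s) a i|) => //.
  by rewrite normr_gt0.
move=> N; have [m Nm mE] := second_diff_sum_tent t a s N.
exists m => // k; rewrite mE normrN normrM [X in _ <= _ * X]ger0_norm//.
Qed.

End Family.

(** * Lineability through the span of the family *)

Theorem proposition4p2 (R : realType) (alpha : R)
    (alpha_gt0 : 0 < alpha) (alpha_lt1 : alpha < 1) :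
  lineable [set: R]
    [set f : unit_itv R -> R | f \in holder_space alpha /\
       forall x : unit_itv R, holder_exponent f x = alpha%:E].
Proof.
have range_reindex n (v : 'I_n -> unit_itv R -> R) :
    (forall i, range (tent_family alpha) (v i)) ->
    exists t, v = tent_family alpha \o t.
  move=> vB; have /choice[t tE] i : exists t, tent_family alpha t = v i.
    by have [t _ <-] := vB i; exists t.
  by exists t; apply/funext => i /=.
exists (linear_span (range (tent_family alpha))); split.
- exact: linear_span_submod.
- exists (range (tent_family alpha)); split; first split => //.
    move=> n v c v_inj /range_reindex[t vE] + i; rewrite vE in v_inj *.
    move=> /sum_tent_family_eq0/(_ (t i)).
    (* The vectors are distinct, so the fiber of [t] over [t i] is reduced to [i]. *)
    rewrite (big_pred1 i)// => j; apply/eqP/eqP => [tji|->//].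
    by apply: v_inj => /=; rewrite tji.
  by apply: inj_card_eq => s t _ _; exact: tent_family_inj.
- move=> f [n [v [a [/range_reindex[t ->] ->]]]].
  (* A nonzero fiber sum yields exponent [alpha] everywhere; if all of them vanish, the combination
     is 0. *)
  have [/existsNP[s /eqP A0]|A0] :=
    pselect (~ forall s, \sum_(i | t i == s) a i = 0).
    left; split; first exact: sum_tent_family_holder.
    by move=> x; exact: sum_tent_family_exponent A0.
  by right; exact: (sum_scale_fibers (tent_family alpha) (contrapT A0)).
Qed.
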